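(* Let $E \subseteq \mathbb{R}$. Then $E$ is removable if and only if $E$ has no perfect subsets.
   Context: A set $E \subseteq \mathbb{R}$ is called removable if the following condition holds: whenever $f:\mathbb{R}\to\mathbb{R}$ is a continuous function such that $f$ is differentiable with derivative $0$ at every point of $\mathbb{R}\setminus E$, then $f$ is constant on $\mathbb{R}$. A subset $A$ of $\mathbb{R}$ is a perfect set if $A$ is non-empty and closed in $\mathbb{R}$, and $A$ has no isolated points. (In particular, perfect sets are non-empty by convention.) *)

(* Defs.v *)
From mathcomp Require Import all_boot all_order all_algebra.
From mathcomp Require Import all_classical all_reals all_analysis.

Set Implicit Arguments.
Unset Strict Implicit.
Unset Printing Implicit Defensive.

Import Order.TTheory GRing.Theory Num.Theory.
Import numFieldNormedType.Exports.

Local Open Scope classical_set_scope.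
Local Open Scope ring_scope.

(* [is_derive x 1 f 0] bundles the differentiability of [f] at [x] with the
   equation "derivative = 0"; the equation alone would not suffice, since the
   library derivative is a total operator. *)
Definition removable (R : realType) (E : set R) : Prop :=
  forall f : R -> R, continuous f ->
    (forall x : R, (~` E) x -> is_derive x 1 f 0) ->
    exists c : R, forall x : R, f x = c.

(* The library's [perfect_set] also holds of [set0], hence this definition;
   for closed sets, [isolated A = set0] and [limit_point A = A] agree
   (lemma [perfectP]). *)
Definition nonempty_perfect (R : realType) (A : set R) : Prop :=
  [/\ A !=set0, closed A & isolated A = set0].

(* Main.v *)
(** If [f a < f b], tilt [f] to [g = f - e id] with [g a < g b] and, for each
    [y] in [`]g a, g b[], consider the last point where [g] takes the value
    [y]: there the right slopes of [f] are at least [e], so [f' = 0] fails.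
    Discarding the countably many values attained twice as a minimum of [g]
    over a final segment, the values in a closed uncountable set [K] give a
    closed uncountable set of such points, which contains a perfect set by
    Cantor-Bendixson.

    Conversely, let [A] be perfect. Whenever [A] meets an interval [`]x, y[],
    it has a point [z] there such that [A] meets both [`]x, z[] and [`]z, y[].
    Bisecting repeatedly at such points, and averaging rescaled ramps, gives
    continuous functions converging uniformly to a devil's staircase that is
    locally constant off [A]. *)

Require Import Defs.
From mathcomp Require Import all_boot all_order all_algebra.
From mathcomp Require Import all_classical all_reals all_analysis.
From mathcomp Require Import ring lra.

Set Implicit Arguments.
Unset Strict Implicit.
Unset Printing Implicit Defensive.

Import Order.TTheory GRing.Theory Num.Theory.
Import numFieldNormedType.Exports.

Local Open Scope classical_set_scope.
Local Open Scope ring_scope.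

(** * Uncountable closed subsets of the line *)

Lemma countable_setU (T : Type) (A B : set T) :
  countable A -> countable B -> countable (A `|` B).
Proof.
move=> cA cB; rewrite -bigcup2E; apply: bigcup_countable => //.
by move=> [|[|i]] _ //=; exact: countable0.
Qed.

Lemma nbhs_rat_itv (R : realType) (x : R) (V : set R) : nbhs x V ->
  exists pq : rat * rat,
    ratr pq.1 < x < ratr pq.2 /\ `]ratr pq.1, ratr pq.2[ `<=` V.
Proof.
move=> /nbhs_ballP[e /= e0 eV].
have [p] : exists p, ratr p \in `]x - e, x[ by apply: rat_in_itvoo; lra.
have [q] : exists q, ratr q \in `]x, x + e[ by apply: rat_in_itvoo; lra.
rewrite !in_itv /= => /andP[xq qe] /andP[ep px].
exists (p, q); split=> /=; first by rewrite px xq.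
move=> y /=; rewrite in_itv /= => /andP[py yq]; apply: eV.
by rewrite /ball /= ltr_norml; apply/andP; split; lra.
Qed.

(** Cantor-Bendixson: [N] is the union of the rational intervals in which [C] is countable, so [C]
    loses only countably many points when [N] is removed. If a remaining point [x] were isolated,
    some rational interval around it would meet [C] only in [x] and in points of [N], which puts [x]
    in [N]. *)
Lemma uncountable_closed_has_perfect (R : realType) (C : set R) :
  closed C -> ~ countable C -> exists P : set R, nonempty_perfect P /\ P `<=` C.
Proof.
move=> clC ncC.
pose I (pq : rat * rat) : set R := `]ratr pq.1, ratr pq.2[%classic.
pose N := \bigcup_(pq in [set pq | countable (C `&` I pq)]) I pq.
have oN : open N by apply: bigcup_open => i _; exact: itv_open.
have cN : countable (C `&` N).
  rewrite setI_bigcupr; apply: bigcup_countable => //; exact: countableP.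
exists (C `&` ~` N); split; last by move=> x [].
split.
- apply: contrapT => /set0P/negP; rewrite negbK => /eqP P0; apply: ncC.
  rewrite -(setUIDK C N); apply: countable_setU => //.
  by rewrite setDE P0; exact: countable0.
- by apply: closedI => //; exact: open_closedC.
- rewrite -subset0 => x [/set_mem[Cx nNx] [V Vx VP]].
  have [pq [xpq pqV]] := nbhs_rat_itv Vx.
  apply: nNx; exists pq; last by rewrite /I /= in_itv.
  apply: (@sub_countable _ _ _ ((C `&` N) `|` [set x])).
    apply: subset_card_le => y [Cy Iy]; have [Ny|nNy] := pselect (N y).
      by left.
    by right; rewrite -VP; split=> //; exact: pqV.
  exact: countable_setU.
Qed.

Lemma lebesgue_measureD_countable (R : realType) (D J : set R) :
  measurable D -> countable J ->
  lebesgue_measure (D `\` J) = lebesgue_measure D.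
Proof.
move=> mD cJ; have mJ : measurable J by exact: countable_measurable.
have mDJ : measurable (D `\` J) by exact: measurableD.
apply/eqP; rewrite eq_le; apply/andP; split.
  by apply: le_measure; rewrite ?inE //; exact: subIsetl.
apply: (@le_trans _ _ (lebesgue_measure ((D `\` J) `|` J))).
  apply: le_measure; rewrite ?inE //; first exact: measurableU.
  by move=> x Dx; have [Jx|nJx] := pselect (J x); [right|left].
have /le_trans := measureU2 lebesgue_measure mDJ mJ; apply.
by have /= -> := countable_lebesgue_measure0 cJ; rewrite adde0.
Qed.

(** Removing [J] keeps the measure [b - a]. Inner regularity gives a compact [K] missing less than
    that; a countable [K] would miss all of it. *)
Lemma uncountable_closed_avoiding_countable (R : realType) (a b : R)
    (J : set R) :
  a < b -> countable J ->
  exists K : set R,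
    [/\ closed K, ~ countable K, K `<=` `]a, b[ & K `&` J = set0].
Proof.
move=> ab cJ; pose D : set R := `]a, b[%classic `\` J.
have mD : measurable D.
  by apply: measurableD => //; exact: countable_measurable.
have muD : lebesgue_measure D = (b - a)%:E.
  apply: etrans (lebesgue_measureD_countable _ cJ) _ => //.
  by rewrite lebesgue_measure_itv /= lte_fin ab EFinN.
have finD : (lebesgue_measure D < +oo)%E by rewrite muD ltry.
have ba0 : 0 < b - a by rewrite subr_gt0.
have [K [cK KD KDe]] := lebesgue_regularity_inner mD finD ba0.
exists K; split.
- exact: compact_closed (@Rhausdorff R) cK.
- move=> cntK; have /= muDK := lebesgue_measureD_countable mD cntK.
  by move: KDe; rewrite [X in (X < _)%E](etrans muDK muD) ltxx.
- by move=> x /KD[].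
- by rewrite -subset0 => x [/KD[_ nJx]].
Qed.

(** * Points of increase of a non-constant function *)

(** The point is the supremum [s] of the closed set where [g <= y]. If [g s < y], the intermediate
    value theorem on [[s, b]] would give a later point of that set. *)
Lemma exists_last_visit (R : realType) (g : R -> R) (a b y : R) :
  continuous g -> a < b -> g a < y < g b ->
  exists x, [/\ a <= x <= b, g x = y & forall t, x < t <= b -> y < g t].
Proof.
move=> gc ab /andP[gay ygb].
pose S : set R := `[a, b] `&` [set x | g x <= y].
have Sa : S a by split; [rewrite /= bound_itvE ltW | exact: ltW].
have Sb : ubound S b by move=> x [/=]; rewrite in_itv /= => /andP[].
have clS : closed S.
  apply: closedI; first exact: itv_closed.
  apply: (@preimage_closed _ _ g [set z | z <= y]); last exact: closed_le.
  by move=> z _; exact: gc.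
have : S (sup S).
  rewrite [X in X _](closure_id S).1 //; apply: closure_sup; first by exists a.
  by exists b.
set s := sup S; move=> [/=]; rewrite in_itv /= => /andP[as_ sb] gsy.
have last t : s < t <= b -> y < g t.
  move=> /andP[st tb]; rewrite ltNge; apply/negP => gty.
  have : t <= s.
    apply: ub_le_sup; first by exists b.
    by split => //=; rewrite in_itv /= tb (le_trans as_ (ltW st)).
  by rewrite leNgt st.
exists s; split; [by rewrite as_ sb| |exact: last].
apply/eqP; rewrite eq_le gsy leNgt /=; apply/negP => gs.
have [||c] := @IVT R g s b y sb.
- by apply: continuous_subspaceT.
- by rewrite ge_min le_max (ltW gs) (ltW ygb) orbT.
rewrite in_itv /= => /andP[sc cb] gcy.
have := sc; rewrite le_eqVlt => /orP[/eqP sc'|sc'].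
  by move: gs; rewrite sc' gcy ltxx.
by have := last c; rewrite sc' cb gcy ltxx => /(_ isT).
Qed.

Lemma is_derive0_upper_slope (R : realType) (f : R -> R) (x e : R) : 0 < e ->
  is_derive x 1 f 0 -> \forall t \near x^'+, f t - f x < e * (t - x).
Proof.
move=> e0 /is_derive1_caratheodory[g [fE gc gx0]].
have ge : \forall t \near x, g t < e.
  by move/cvgr_lt : gc => /(_ e); apply; rewrite gx0.
near=> t; rewrite fE ltr_pM2r; first by near: t; exact: cvg_within ge.
by rewrite subr_gt0; near: t; exact: nbhs_right_gt.
Unshelve. all: by end_near. Qed.

Lemma increase_has_perfect (R : realType) (f : R -> R) (a b : R) :
  continuous f -> a < b -> f a < f b ->
  exists P : set R, nonempty_perfect P /\
    forall x, P x -> ~ is_derive x 1 f 0.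
Proof.
move=> fc ab fab.
(* Half the mean slope of [f], so the tilt leaves half of the increase:
   [g b - g a = (f b - f a) / 2]. *)
pose e := (f b - f a) / (2 * (b - a)).
have e0 : 0 < e by rewrite divr_gt0 ?subr_gt0 // mulr_gt0 // subr_gt0.
have eE : e * (b - a) = (f b - f a) / 2 by rewrite /e; field; lra.
pose g x := f x - e * x.
have gc : continuous g.
  move=> x; apply: cvgB; first exact: fc.
  by apply: cvgM; [exact: cvg_cst|exact: cvg_id].
have gab : g a < g b by rewrite /g; lra.
(* Rational starting points keep [J] countable, and they suffice: there is a rational strictly
   between any two points where [g] takes the same value. *)
pose J : set R := range (fun r : rat => inf (g @` `[ratr r, b])).
have cJ : countable J.
  apply: sub_countable (card_image_le _ _) _; exact: countableP.
have [K [clK ncK Kab KJ]] := uncountable_closed_avoiding_countable gab cJ.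
(* Points from which [g] never drops lower. The weak inequality, rather than that of a last visit,
   makes [A] closed; strictness is recovered from [K] avoiding [J]. *)
pose A : set R := `[a, b] `&` (g @^-1` K) `&`
  \bigcap_(t in `[a, b]) ([set x | t <= x] `|` [set x | g x <= g t]).
have clA : closed A.
  apply: closedI; first apply: closedI.
  - exact: itv_closed.
  - by apply: preimage_closed => // x _; exact: gc.
  - apply: closed_bigI => t _; apply: closedU; first exact: closed_ge.
    apply: (@preimage_closed _ _ g [set z | z <= g t]); last exact: closed_le.
    by move=> z _; exact: gc.
have gA : K `<=` g @` A.
  move=> y Ky; have /= := Kab _ Ky; rewrite in_itv /= => yab.
  have [x [xab gxy xl]] := exists_last_visit gc ab yab.
  exists x => //; split; first by split; rewrite /= ?in_itv //= gxy.
  move=> t /=; rewrite in_itv /= => /andP[_ tb].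
  have [xt|] := ltP x t; last by left.
  by right; rewrite /= gxy ltW // xl // xt.
have ncA : ~ countable A.
  move=> cA; apply: ncK; apply: sub_countable (subset_card_le gA) _.
  exact: sub_countable (card_image_le _ _) cA.
have [P [pP PA]] := uncountable_closed_has_perfect clA ncA.
exists P; split=> // x /PA[[/= xab Kgx] xlast] fx.
move: xab; rewrite in_itv /= => /andP[ax xb].
have xltb : x < b.
  rewrite lt_neqAle xb andbT; apply/eqP => xeb.
  by have := Kab _ Kgx; rewrite /= in_itv /= xeb ltxx andbF.
have gle t : x < t <= b -> g x <= g t.
  move=> /andP[xt tb]; have [|/=|//] := xlast t.
    by rewrite /= in_itv /= tb (le_trans ax (ltW xt)).
  by rewrite leNgt xt.
have glt t : x < t <= b -> g x < g t.
  move=> /[dup] /gle gxt /andP[xt tb]; rewrite lt_neqAle gxt andbT.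
  (* If [g] returns to its minimal value [g x] at [t], then [g x] is the infimum over [[r, b]] for
     any rational [r] between [x] and [t], hence lies in [J]. *)
  apply/eqP => gxtE; have [r] := rat_in_itvoo xt.
  rewrite in_itv /= => /andP[xr rt].
  have : (K `&` J) (g x); last by rewrite KJ.
  split=> //; exists r => //.
  have lb : lbound (g @` `[ratr r, b]) (g x).
    move=> _ [s + <-]; rewrite /= in_itv /= => /andP[rs sb].
    by apply: gle; rewrite sb (lt_le_trans xr rs).
  have gxin : (g @` `[ratr r, b]) (g x).
    by rewrite gxtE; exists t => //=; rewrite in_itv /= tb (ltW rt).
  apply/eqP; rewrite eq_le lb_le_inf // ?andbT; last by exists (g x).
  by apply: ge_inf => //; exists (g x).
have /filter_ex[t [xt tb ft]] :
    \forall t \near x^'+, [/\ x < t, t <= b & f t - f x < e * (t - x)].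
  near=> t; split; near: t; [exact: nbhs_right_gt|exact: nbhs_right_ltW|].
  exact: is_derive0_upper_slope.
have := glt t; rewrite xt tb => /(_ isT); rewrite /g; lra.
Unshelve. all: by end_near. Qed.

(** * Splitting perfect sets, and approximate staircases *)

Definition meets (R : realType) (A : set R) (x y : R) :=
  exists2 w, A w & x < w < y.

Lemma meets_lt (R : realType) (A : set R) (x y : R) : meets A x y -> x < y.
Proof. by case=> w _ /andP[]; exact: lt_trans. Qed.

Lemma perfect_near (R : realType) (A : set R) (w e : R) :
  isolated A = set0 -> A w -> 0 < e ->
  exists v, [/\ A v, v != w & `|v - w| < e].
Proof.
move=> iA Aw e0; apply: contrapT => nv.
have : isolated A w; last by rewrite iA.
split; first exact/mem_set.
exists (ball w e); first exact: nbhsx_ballx.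
apply/seteqP; split=> [v [wv Av] /=|v -> /=]; last by split; [exact: ballxx|].
apply: contrapT => vw; apply: nv; exists v; split=> //; first exact/eqP.
by rewrite distrC.
Qed.

(** Near [w] there is a second point of [A], giving [p < q]; near [q] there is a third one, [r],
    still right of [p]. The middle one of the three is [z]. *)
Lemma perfect_meets_dense (R : realType) (A : set R) (x y : R) :
  isolated A = set0 -> meets A x y ->
  exists z, [/\ A z, meets A x z & meets A z y].
Proof.
move=> iA [w Aw /andP[xw wy]].
have [p [q [Ap Aq xp pq qy]]] :
    exists p q, [/\ A p, A q, x < p, p < q & q < y].
  have e0 : 0 < Num.min (w - x) (y - w) by rewrite lt_min !subr_gt0 xw.
  have [v [Av vw]] := perfect_near iA Aw e0.
  rewrite lt_min !ltr_norml => /andP[/andP[? ?] /andP[? ?]].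
  by case: (ltgtP v w) vw => // vw _; [exists v, w|exists w, v]; split=> //; lra.
have e0 : 0 < Num.min (q - p) (y - q) by rewrite lt_min !subr_gt0 pq.
have [r [Ar rq]] := perfect_near iA Aq e0.
rewrite lt_min !ltr_norml => /andP[/andP[? ?] /andP[? ?]].
case: (ltgtP r q) rq => // rq _.
- by exists r; split=> //; [exists p|exists q] => //; apply/andP; split; lra.
- by exists q; split=> //; [exists p|exists r] => //; apply/andP; split; lra.
Qed.

Definition splits (R : realType) (A : set R) (mid : R -> R -> R) :=
  forall x y, meets A x y ->
    [/\ A (mid x y), meets A x (mid x y) & meets A (mid x y) y].

Lemma perfect_splits (R : realType) (A : set R) :
  isolated A = set0 -> exists mid, splits A mid.
Proof.
move=> iA.
have /choice[m mP] : forall xy : R * R, exists z, meets A xy.1 xy.2 ->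
    [/\ A z, meets A xy.1 z & meets A z xy.2].
  (* The value 0 is arbitrary: [splits] constrains [mid] only on intervals that meet [A]. *)
  move=> xy; have [|nA] := pselect (meets A xy.1 xy.2); last by exists 0.
  by move/(perfect_meets_dense iA) => [z zP]; exists z.
by exists (fun x y => m (x, y)) => x y; exact: (mP (x, y)).
Qed.

(* The first summand is 1 right of [mid x y] and the second is 0 left of it, so
   the average glues two half-height copies. *)
Fixpoint staircase (R : realType) (mid : R -> R -> R) (n : nat) (x y t : R) :
    R :=
  if n is n'.+1 then
    (staircase mid n' x (mid x y) t + staircase mid n' (mid x y) y t) / 2
  else Num.min 1 (Num.max 0 ((t - x) / (y - x))).

Lemma staircase_continuous (R : realType) (mid : R -> R -> R) n x y :
  continuous (staircase mid n x y).
Proof.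
elim: n x y => [|n IH] x y t /=.
- change {for t, continuous
    ((fun=> 1 : R^o) \min
     ((fun=> 0 : R^o) \max (fun t => (t - x) / (y - x) : R^o)))}.
  apply: continuous_min; first exact: cvg_cst.
  apply: continuous_max; first exact: cvg_cst.
  apply: cvgM; last exact: cvg_cst.
  by apply: cvgB; [exact: cvg_id|exact: cvg_cst].
- by apply: cvgM; [apply: cvgD; exact: IH|exact: cvg_cst].
Qed.

Lemma staircase_bounds (R : realType) (mid : R -> R -> R) n x y t :
  0 <= staircase mid n x y t <= 1.
Proof.
elim: n x y => [|n IH] x y /=.
  by rewrite le_min ge_min le_max ler01 !lexx.
have /andP[? ?] := IH x (mid x y); have /andP[? ?] := IH (mid x y) y.
by apply/andP; split; lra.
Qed.

Lemma staircase_left (R : realType) (A : set R) (mid : R -> R -> R) n x y t :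
  splits A mid -> meets A x y -> t <= x -> staircase mid n x y t = 0.
Proof.
move=> Am; elim: n x y => [|n IH] x y Axy tx /=.
  rewrite max_l ?min_r // mulr_le0_ge0 ?subr_le0 // invr_ge0 subr_ge0.
  exact: ltW (meets_lt Axy).
have [_ Axz Azy] := Am _ _ Axy.
by rewrite !IH ?addr0 ?mul0r // (le_trans tx (ltW (meets_lt Axz))).
Qed.

Lemma staircase_right (R : realType) (A : set R) (mid : R -> R -> R) n x y t :
  splits A mid -> meets A x y -> y <= t -> staircase mid n x y t = 1.
Proof.
move=> Am; elim: n x y => [|n IH] x y Axy yt /=.
  rewrite min_l // le_max; apply/orP; right.
  by rewrite ler_pdivlMr ?subr_gt0 ?(meets_lt Axy) // mul1r lerB.
have [_ Axz Azy] := Am _ _ Axy.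
rewrite !IH ?(le_trans (ltW (meets_lt Azy)) yt) //; lra.
Qed.

(** On either side of [mid x y] one of the two averaged copies is constantly 0 or 1 at every stage,
    so only the other contributes and the error halves. *)
Lemma staircase_cauchy (R : realType) (A : set R) (mid : R -> R -> R) n x y t :
  splits A mid -> meets A x y ->
  `|staircase mid n.+1 x y t - staircase mid n x y t| <= 2 ^- n.
Proof.
move=> Am; elim: n x y => [|n IH] x y Axy.
  rewrite expr0 invr1 ler_norml.
  have /andP[? ?] := staircase_bounds mid 0 x y t.
  have /andP[? ?] := staircase_bounds mid 1 x y t.
  by apply/andP; split; lra.
have [_ Axz Azy] := Am _ _ Axy.
have := IH _ _ Axz; have := IH _ _ Azy.
have E m : staircase mid m.+1 x y t =
  (staircase mid m x (mid x y) t + staircase mid m (mid x y) y t) / 2 by [].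
rewrite (E n.+1) (E n) exprS invfM !ler_norml => /andP[? ?] /andP[? ?].
have [tz|/ltW zt] := leP t (mid x y).
- rewrite !(@staircase_left _ A _ _ (mid x y) y) //.
  by apply/andP; split; lra.
- rewrite !(@staircase_right _ A _ _ x (mid x y)) //.
  by apply/andP; split; lra.
Qed.

(** As [mid x y] lies in [A], it cannot separate [u] from [v]; one copy takes equal values at both,
    and the variation halves at each level. *)
Lemma staircase_flat (R : realType) (A : set R) (mid : R -> R -> R) n x y u v :
  splits A mid -> meets A x y -> u <= v ->
  (forall w, A w -> ~ (u < w <= v)) ->
  `|staircase mid n x y v - staircase mid n x y u| <= 2 ^- n.
Proof.
move=> Am + uv Auv; elim: n x y => [|n IH] x y Axy.
  rewrite expr0 invr1 ler_norml.
  have /andP[? ?] := staircase_bounds mid 0 x y u.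
  have /andP[? ?] := staircase_bounds mid 0 x y v.
  by apply/andP; split; lra.
have [Az Axz Azy] := Am _ _ Axy.
have := IH _ _ Axz; have := IH _ _ Azy.
rewrite /= exprS invfM !ler_norml => /andP[? ?] /andP[? ?].
have [zu|uz] := leP (mid x y) u.
- rewrite !(@staircase_right _ A _ _ x (mid x y)) ?(le_trans zu uv) //.
  by apply/andP; split; lra.
- have /ltW vz : v < mid x y.
    by rewrite ltNge; apply/negP => zv; apply: (Auv _ Az); rewrite uz.
  rewrite !(@staircase_left _ A _ _ (mid x y) y) ?(le_trans uv vz) //.
  by apply/andP; split; lra.
Qed.

(** * The limit staircase *)

(** The intervals of radius [2 * 2 ^- n] (the geometric tail) around [u n] are nested, and the
    supremum of their left ends lies in all of them. *)
Lemma geometric_cauchy_limit (R : realType) (u : nat -> R) :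
  (forall n, `|u n.+1 - u n| <= 2 ^- n) ->
  exists l, forall n, `|l - u n| <= 2 * 2 ^- n.
Proof.
move=> uP.
have halfS n : 2 * 2 ^- n.+1 = 2 ^- n :> R by rewrite exprS invfM mulVKf.
have ndl : nondecreasing_seq (fun n => u n - 2 * 2 ^- n).
  apply/nondecreasing_seqP => n.
  by have := uP n; rewrite halfS ler_norml => /andP[? ?]; lra.
have niu : nonincreasing_seq (fun n => u n + 2 * 2 ^- n).
  apply/nonincreasing_seqP => n.
  by have := uP n; rewrite halfS ler_norml => /andP[? ?]; lra.
have lu m n : u m - 2 * 2 ^- m <= u n + 2 * 2 ^- n.
  have := ndl _ _ (leq_maxl m n); have := niu _ _ (leq_maxr m n).
  have : 0 <= 2 ^- maxn m n :> R by rewrite invr_ge0 exprn_ge0.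
  move=> /=; lra.
pose S := range (fun n => u n - 2 * 2 ^- n).
have S0 : S !=set0 by exists (u 0%N - 2 * 2 ^- 0), 0%N.
exists (sup S) => n; rewrite ler_norml; apply/andP; split.
- rewrite lerBrDl; apply: ub_le_sup; last by exists n.
  by exists (u 0%N + 2 * 2 ^- 0) => _ [m _ <-].
- by rewrite lerBlDl; apply: ge_sup => // _ [m _ <-].
Qed.

Lemma perfect_staircase_function (R : realType) (A : set R) :
  nonempty_perfect A ->
  exists f : R -> R, [/\ continuous f, forall x, ~ A x -> is_derive x 1 f 0
    & exists x y, f x != f y].
Proof.
move=> [[w Aw] clA iA]; have [mid Am] := perfect_splits iA.
have Ab : meets A (w - 1) (w + 1) by exists w => //; apply/andP; split; lra.
pose F n := staircase mid n (w - 1) (w + 1).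
have /choice[f fF] : forall t, exists l, forall n, `|l - F n t| <= 2 * 2 ^- n.
  move=> t; apply: (@geometric_cauchy_limit _ (F ^~ t)) => n.
  exact: staircase_cauchy Am Ab.
have small (e : R) : 0 < e -> exists n, 2 ^- n < e.
  move=> e0; have : (fun n => 2 ^- n : R) @ \oo --> (0 : R).
    by under eq_fun do rewrite -exprVn; apply: cvg_expr; rewrite gtr0_norm; lra.
  move=> /cvgr_lt /(_ _ e0) [n _ nP]; exists n; exact: nP (leqnn n).
exists f; split.
- move=> t; apply/cvgrPdist_lt => e e0.
  (* Two approximation errors of at most [2 * 2 ^- n] and one continuity error total less than
     [5 * (e / 6)]. *)
  have [n ne] := small (e / 6) ltac:(lra).
  have /cvgrPdist_lt /(_ (e / 6) ltac:(lra)) :=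
    @staircase_continuous R mid n (w - 1) (w + 1) t.
  apply: filterS => s; rewrite -/(F n).
  have := fF t n; have := fF s n.
  rewrite !ler_norml !ltr_norml => /andP[? ?] /andP[? ?] /andP[? ?].
  by apply/andP; split; lra.
- move=> t At.
  have const u v : u <= v -> (forall z, A z -> ~ (u < z <= v)) -> f v = f u.
    move=> uv Auv; apply/eqP; rewrite -subr_eq0 -normr_le0.
    apply/ler_addgt0Pl => e e0; rewrite addr0.
    (* Twice [2 * 2 ^- n] for the approximation, once [2 ^- n] for flatness. *)
    have [n ne] := small (e / 5) ltac:(lra).
    have := staircase_flat n Am Ab uv Auv; rewrite -!/(F n _).
    have := fF u n; have := fF v n.
    rewrite !ler_norml => /andP[? ?] /andP[? ?] /andP[? ?].
    by apply/andP; split; lra.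
  have /nbhs_ballP[e /= e0 eA] : nbhs t (~` A).
    by apply: open_nbhs_nbhs; split=> //; exact: closed_openC.
  apply: (@near_eq_is_derive _ _ _ (cst (f t))).
  near=> s; rewrite /cst.
  have ts : ball t e s by near: s; exact: nbhsx_ballx.
  have ballA z : `|t - z| < e -> ~ A z by exact: eA.
  move: ts; rewrite /ball /= ltr_norml => /andP[? ?].
  have [le_ts|/ltW st] := leP t s; [apply/esym|];
    apply: const => // z Az /andP[? ?];
    by apply: (ballA z) => //; rewrite ltr_norml; apply/andP; split; lra.
- exists (w - 1), (w + 1); apply/eqP => fE.
  (* At stage 3 the error is at most 1/4 at each end, too small to join the values 0 and 1. *)
  have := fF (w - 1) 3; have := fF (w + 1) 3.
  rewrite /F (staircase_left 3 Am Ab (lexx _)) (staircase_right 3 Am Ab (lexx _)) {}fE !ler_norml.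
  have -> : 2 ^- 3 = 1 / 8 :> R by rewrite div1r -natrX.
  move=> /andP[? ?] /andP[? ?].
  have : (1 : R) < 1 by lra.
  by rewrite ltxx.
Unshelve. all: by end_near. Qed.

Theorem mainTheorem1 (R : realType) (E : set R) :
  removable E <-> ~ (exists A : set R, nonempty_perfect A /\ A `<=` E).
Proof.
split=> [rE [A [pA AE]]|nE f fc fE].
- have [f [fc fA [x [y]]]] := perfect_staircase_function pA.
  have [|c fcst] := rE f fc; last by rewrite !fcst eqxx.
  by move=> z nEz; apply: fA => /AE.
(* Stated for any [g], to be applied to both [f] and [- f]. *)
- have nlt (g : R -> R) a b : continuous g ->
      (forall x, (~` E) x -> is_derive x 1 g 0) -> a < b -> ~ (g a < g b).
    move=> gc gE ab gab; have [P [pP Pg]] := increase_has_perfect gc ab gab.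
    apply: nE; exists P; split=> // x Px; apply: contrapT => nEx.
    exact: Pg Px (gE _ nEx).
  have const a b : a < b -> f a = f b.
    move=> ab; case: (ltgtP (f a) (f b)) => // fab.
    + by have := nlt f a b fc fE ab fab.
    + have Nfc : continuous (- f) by move=> x; apply: cvgN; exact: fc.
      have NfE x : (~` E) x -> is_derive x 1 (- f) 0.
        by move=> /fE fx; apply: is_derive_eq; exact: oppr0.
      by have /(_ ab) := nlt (- f) a b Nfc NfE; rewrite ltrN2.
  exists (f 0) => x; case: (ltgtP x 0) => [/const//|/const/esym//|-> //].
Qed.
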